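(* There are absolute constants $C,T_0>0$ such that the following holds. For all integers $k,S\ge 1$, there is a (randomized) player algorithm for the stateful policies model which, given as input any reference set $\Pi$ of $k$ stateful policies over $S$ states (over any finite set $[n]$ of actions) and the number of rounds $T\ge T_0$, satisfies, for every oblivious sequence of reward functions $r_1,\dots,r_T:[n]\to[0,1]$, $$\mathrm{Regret}_T \;\le\; C\,\sqrt{kS}\cdot\frac{T\log\log T}{\log^{1/4}T}.$$ In particular, for any given $k$ and $S$ the algorithm guarantees expected regret sublinear in $T$.
   Context: Stateful policies model. There are $T$ rounds and a set $[n]=\{1,\dots,n\}$ of actions. Before the game begins, an oblivious adversary fixes reward functions $r_1,\dots,r_T:[n]\to[0,1]$. On each round $t$ the player chooses, possibly at random and based on everything observed so far, an action $X_t\in[n]$, receives the reward $r_t(X_t)$, and observes only this reward (bandit feedback). A stateful policy $\pi=(s_0^\pi,f^\pi,g^\pi)$ over $n$ actions and $S$ states consists of an initial state $s_0^\pi\in[S]$, an action function $f^\pi:[S]\to[n]$, and a state transition function $g^\pi:[S]\times[0,1]\to[S]$. Had $\pi$ been followed from the beginning of the game, its actions $x_t^\pi$ and states $s_t^\pi$ are given recursively for $t=1,\dots,T$ by $x_t^\pi=f^\pi(s_{t-1}^\pi)$ and $s_t^\pi=g^\pi(s_{t-1}^\pi,r_t(x_t^\pi))$. The player is given the full description of the reference policies in $\Pi$. The expected regret with respect to $\Pi$ is $$\mathrm{Regret}_T=\max_{\pi\in\Pi}\sum_{t=1}^T r_t(x_t^\pi)-\mathbf E\Big[\sum_{t=1}^T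 r_t(X_t)\Big],$$ the expectation being over the player's randomization. *)

(* Defs.v *)
From HB Require Import structures.
From mathcomp Require Import all_boot all_order all_algebra finmap.
From mathcomp Require Import all_classical all_reals all_analysis.

Set Implicit Arguments.
Unset Strict Implicit.
Unset Printing Implicit Defensive.

Import Order.TTheory GRing.Theory Num.Theory.
Import numFieldNormedType.Exports.

Local Open Scope ring_scope.

(* Actions, states and rounds are numbered from 0:
   [r t] is the reward function of round t + 1.  Reward sequences are indexed
   by all of nat, but in a game of T rounds only [r 0, ..., r (T - 1)] are
   used.  [{i01 R}] is the type of reals in [0, 1]. *)

Definition rewards (R : realType) (n : nat) := nat -> 'I_n -> {i01 R}.

Record stateful_policy (R : realType) (n S : nat) := StatefulPolicy {
  init_state : 'I_S ;
  action_of : 'I_S -> 'I_n ;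
  next_state : 'I_S -> {i01 R} -> 'I_S }.

(* Classical equality and choice, so that finite sets of policies can be
   formed although [next_state] has an infinite domain. *)
HB.instance Definition _ (R : realType) (n S : nat) :=
  gen_eqMixin (stateful_policy R n S).
HB.instance Definition _ (R : realType) (n S : nat) :=
  gen_choiceMixin (stateful_policy R n S).

Section Policy.
Variables (R : realType) (n S : nat).
Variables (pi : stateful_policy R n S) (r : rewards R n).

(* The state after t rounds. *)
Fixpoint policy_state (t : nat) : 'I_S :=
  if t is t'.+1 then
    let s := policy_state t' in next_state pi s (r t' (action_of pi s))
  else init_state pi.

Definition policy_action (t : nat) : 'I_n := action_of pi (policy_state t).

Definition policy_reward (T : nat) : R :=
  \sum_(t < T) (r t (policy_action t))%:num.

End Policy.

Definition reference_set (R : realType) (n S k : nat) :=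
  {Pi : {fset stateful_policy R n S} | #|` Pi| == k}.

Record action_dist (R : realType) (n : nat) := ActionDist {
  pmf :> 'I_n -> R ;
  pmf_ge0 : forall i, 0 <= pmf i ;
  pmf_sum1 : \sum_i pmf i = 1 }.

(* A randomized player maps the chronological list of its past actions and
   observed rewards to the conditional distribution of its next action. *)
Definition player (R : realType) (n : nat) :=
  seq ('I_n * {i01 R}) -> action_dist R n.

Section Player.
Variables (R : realType) (n : nat) (p : player R n) (r : rewards R n).
Variable T : nat.

Definition history (x : {ffun 'I_T -> 'I_n}) (t : nat) : seq ('I_n * {i01 R}) :=
  [seq (x s, r s (x s)) | s : 'I_T <- enum 'I_T & (s < t)%N].

(* The probability that the actions of the player are x. *)
Definition play_prob (x : {ffun 'I_T -> 'I_n}) : R :=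
  \prod_(t < T) p (history x t) (x t).

Definition expected_reward : R :=
  \sum_(x : {ffun 'I_T -> 'I_n})
    play_prob x * \sum_(t < T) (r t (x t))%:num.

End Player.

(* Policy rewards are nonnegative, so the default value 0 of the maximum is
   immaterial as soon as the reference set is nonempty. *)
Definition regret (R : realType) (n S k : nat) (Pi : reference_set R n S k)
    (p : player R n) (r : rewards R n) (T : nat) : R :=
  \big[Num.max/0]_(pi <- sval Pi) policy_reward pi r T - expected_reward p r T.

(* The player's algorithm, for given k and S: its input is the number of
   actions n, the reference set and the number of rounds. *)
Definition algorithm (R : realType) (k S : nat) :=
  forall n : nat, reference_set R n S k -> nat -> player R n.

(* Main.v *)
(* The pairs (policy, state) form K = kS "arms"; playing an arm means following
   its policy from that state on, and the player's ignorance of the true states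
   is ignorance of the best arm.  Let V(B) be the best gain of an arm over a
   block B of consecutive rounds.  V is subadditive under concatenation, so the
   mean of (V(B)/|B|)^2 over the blocks of length M^j is nonincreasing in j and
   stays in [0, 1].  Hence at a random scale j it hardly drops, and then for
   most blocks B of length M^(j+1) the best arm of B is nearly optimal on each
   of the M phases of B, with nearly the same value on all of them.  On such a
   block it suffices to explore N random arms, and afterwards to hold the
   current arm while its value stays close to the best value seen, jumping to a
   uniformly random arm otherwise: each jump hits the best arm of B with
   probability 1/K, and that arm is never dropped, so about K phases are
   wasted. *)

Require Import Defs.
From HB Require Import structures.
From mathcomp Require Import all_boot all_order all_algebra finmap.
From mathcomp Require Import all_classical all_reals all_analysis.
From mathcomp Require Import perm ring lra.

Set Implicit Arguments.
Unset Strict Implicit.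
Unset Printing Implicit Defensive.

Import Order.TTheory GRing.Theory Num.Theory.
Import numFieldNormedType.Exports.

Local Open Scope ring_scope.

(** * Runs and gains of deterministic machines driven by the observed rewards *)

Section Machine.
Variables (R : realType) (n : nat) (X : Type).
Variables (act : X -> 'I_n) (nxt : X -> {i01 R} -> X) (r : rewards R n).

Fixpoint run (x : X) (t m : nat) : X :=
  if m is m'.+1 then
    let y := run x t m' in nxt y (r (t + m')%N (act y))
  else x.

Definition gain (x : X) (t m : nat) : R :=
  \sum_(i < m) (r (t + i)%N (act (run x t i)))%:num.

Lemma runD x t m m' : run x t (m + m') = run (run x t m) (t + m) m'.
Proof. by elim: m' => [|m' IH]; rewrite ?addn0 // addnS /= IH addnA. Qed.

Lemma gainS x t m :
  gain x t m.+1 = gain x t m + (r (t + m)%N (act (run x t m)))%:num.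
Proof. by rewrite /gain big_ord_recr. Qed.

Lemma gainD x t m m' :
  gain x t (m + m') = gain x t m + gain (run x t m) (t + m) m'.
Proof.
rewrite /gain big_split_ord /=; congr (_ + _).
by apply: eq_bigr => i _; rewrite runD addnA.
Qed.

Lemma gain_ge0 x t m : 0 <= gain x t m.
Proof. by apply: sumr_ge0 => i _; apply: ge0. Qed.

Lemma gain_le x t m : gain x t m <= m%:R.
Proof.
rewrite -[m in leRHS]card_ord -sumr_const.
by apply: ler_sum => i _; apply: le1.
Qed.

Lemma gain_mono x t m m' : (m <= m')%N -> gain x t m <= gain x t m'.
Proof. by move=> /subnKC <-; rewrite gainD lerDl gain_ge0. Qed.

End Machine.

(** * A player realising a uniform mixture of deterministic machines *)

Section Mixture.
Variables (R : realType) (n : nat) (X : Type) (W : finType) (w0 : W).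
Variables (act : X -> 'I_n) (nxt : W -> X -> {i01 R} -> X) (x0 : W -> X).

Let step w (xb : X * bool) (e : 'I_n * {i01 R}) : X * bool :=
  (nxt w xb.1 e.2, xb.2 && (act xb.1 == e.1)).

Let replay w h : X * bool := foldl (step w) (x0 w, true) h.

Let next w h := act (replay w h).1.

Let compat h : {set W} := [set w | (replay w h).2].

(* The conditional law of the next action given that the realised actions agree
   with the history; outside the support, an arbitrary choice. *)
Let mix_pmf h (a : 'I_n) : R :=
  if compat h == finset.set0 then (a == next w0 h)%:R
  else #|[set w in compat h | next w h == a]|%:R / #|compat h|%:R.

Let mix_pmf_ge0 h a : 0 <= mix_pmf h a.
Proof. by rewrite /mix_pmf; case: ifP => _; rewrite ?divr_ge0 ?ler0n. Qed.

Let mix_pmf_sum1 h : \sum_a mix_pmf h a = 1.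
Proof.
rewrite /mix_pmf; case h0: (compat h == finset.set0).
  by rewrite (bigD1 (next w0 h)) //= eqxx big1 ?addr0 // => a /negPf ->.
rewrite -mulr_suml -(natr_sum R).
suff -> : (\sum_a #|[set w in compat h | next w h == a]| = #|compat h|)%N.
  by rewrite divff // pnatr_eq0 cards_eq0 h0.
rewrite -sum1_card (partition_big (next^~ h) xpredT) //=.
by apply: eq_bigr => a _; rewrite -sum1_card; apply: eq_bigl => w; rewrite !inE.
Qed.

Let mix : player R n := fun h => ActionDist (mix_pmf_ge0 h) (mix_pmf_sum1 h).

Let hist (r : rewards R n) (y : nat -> 'I_n) t :=
  [seq (y m, r m (y m)) | m <- iota 0 t].

Let histS r y t : hist r y t.+1 = rcons (hist r y t) (y t, r t (y t)).
Proof. by rewrite /hist -[t.+1]addn1 iotaD map_cat /= cats1. Qed.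

Let historyE r T (x : {ffun 'I_T -> 'I_n}) (y : nat -> 'I_n) t :
  (forall s : 'I_T, x s = y s) -> (t <= T)%N -> history r x t = hist r y t.
Proof.
move=> xy tT; rewrite /history /hist.
under eq_map => s do rewrite xy.
rewrite (map_comp (fun m => (y m, r m (y m))) val); congr map.
rewrite -(filter_map val (fun m => (m < t)%N)) val_enum_ord.
have <- := filter_iota_ltn 0 tT.
by [].
Qed.

(** The product telescopes: the factor of round [t] is the fraction of the seeds compatible so far
    that stay compatible. Once no seed is left, both sides are 0, whatever the default law. *)
Let prodE r y T : \prod_(t < T) mix (hist r y t) (y t) =
  #|compat (hist r y T)|%:R / #|W|%:R.
Proof.
elim: T => [|T IH].
  rewrite big_ord0 /compat /=.
  rewrite (_ : finset _ = finset.setT); last first.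
    by apply/finset.setP => w; rewrite !inE.
  rewrite cardsT divff //.
  by rewrite pnatr_eq0 -lt0n; apply/card_gt0P; exists w0.
rewrite big_ord_recr /= IH.
have sub : compat (hist r y T.+1) =
    [set w in compat (hist r y T) | next w (hist r y T) == y T].
  by apply/finset.setP => w; rewrite !inE histS /replay foldl_rcons.
rewrite sub /mix_pmf; case: ifPn => [/eqP ->|ne].
  rewrite cards0 !mul0r; set A := finset _.
  have -> : A = finset.set0 by apply/finset.setP => w; rewrite !inE.
  by rewrite cards0 mul0r.
by rewrite mulrC mulrA divfK // pnatr_eq0 cards_eq0.
Qed.

Let replayE r y w T :
  (forall t, (t < T)%N -> y t = act (run act (nxt w) r (x0 w) 0 t)) ->
  replay w (hist r y T) = (run act (nxt w) r (x0 w) 0 T, true).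
Proof.
elim: T => [//|T IH] yE.
rewrite histS /replay foldl_rcons -/(replay _ _) IH; last first.
  by move=> t tT; apply: yE; rewrite ltnS ltnW.
by rewrite /step /= yE // eqxx.
Qed.

Let compatP r y w T : reflect
  (forall t, (t < T)%N -> y t = act (run act (nxt w) r (x0 w) 0 t))
  (w \in compat (hist r y T)).
Proof.
rewrite inE; apply: (iffP idP) => [|/replayE -> //].
elim: T => [//|T IH].
rewrite histS /replay foldl_rcons -/(replay _ _) /= => /andP[/IH h].
rewrite replayE //= => /eqP e t; rewrite ltnS leq_eqVlt => /predU1P[-> //|].
exact: h.
Qed.

(** An instance of Kuhn's theorem: drawing a seed [w] uniformly before the game and playing the
    conditional laws [mix] round by round give the same distribution of plays. *)
Lemma mixture_player : exists p : player R n, forall (r : rewards R n) T,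
  expected_reward p r T =
    (\sum_w gain act (nxt w) r (x0 w) 0 T) / #|W|%:R.
Proof.
exists mix => r T; rewrite /expected_reward /play_prob.
pose ext (x : {ffun 'I_T -> 'I_n}) m :=
  if insub m is Some s then x s else act (x0 w0).
have extE (x : {ffun 'I_T -> 'I_n}) (s : 'I_T) : x s = ext x s.
  by rewrite /ext valK.
pose path w : {ffun 'I_T -> 'I_n} :=
  [ffun t : 'I_T => act (run act (nxt w) r (x0 w) 0 t)].
have compE x w : (w \in compat (hist r (ext x) T)) = (x == path w).
  apply/compatP/eqP => [h|-> t tT].
    by apply/ffunP => t; rewrite ffunE extE h.
  by rewrite (_ : t = Ordinal tT) // -extE ffunE.
(* The probability of [x] is the proportion of seeds whose path is [x], so the expectation can be
   summed seed by seed. *)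
transitivity (\sum_(x : {ffun 'I_T -> 'I_n}) \sum_(w | x == path w)
    (\sum_(t < T) (r t (x t))%:num) / #|W|%:R).
  apply: eq_bigr => x _.
  rewrite (eq_bigr (fun t : 'I_T => mix (hist r (ext x) t) (ext x t)));
    last first.
    by move=> t _; rewrite (historyE r (extE x)) 1?ltnW // -extE.
  rewrite prodE sumr_const -mulr_natl.
  have -> : #|compat (hist r (ext x) T)| = #|[pred w | x == path w]|.
    by apply: eq_card => w; rewrite compE.
  ring.
rewrite (exchange_big_dep xpredT) //= mulr_suml; apply: eq_bigr => w _.
rewrite (big_pred1 (path w)) //; congr (_ / _).
by apply: eq_bigr => t _; rewrite ffunE add0n.
Qed.

End Mixture.

(** * The hold-or-jump rule on a single block of phases *)

Section HoldOrJump.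
Variables (R : realType) (Q : finType).

(** Independence of a uniform coordinate: exchanging [a] and [b] at coordinate [k] leaves [f] fixed,
    so every value [b] of that coordinate receives the same share of the sum. *)
Lemma sum_indep (m : nat) (f : {ffun 'I_m -> Q} -> R) (k : 'I_m) (a : Q) :
  (forall u u' : {ffun 'I_m -> Q}, (forall j, j != k -> u j = u' j) ->
    f u = f u') ->
  \sum_u f u * (u k == a)%:R = (\sum_u f u) / #|Q|%:R.
Proof.
move=> fk; have Q0 : #|Q|%:R != 0 :> R.
  by rewrite pnatr_eq0 -lt0n; apply/card_gt0P; exists a.
apply: (mulIf Q0); rewrite divfK //.
pose sw b (u : {ffun 'I_m -> Q}) :=
  [ffun j => if j == k then tperm a b (u j) else u j].
have swK b : involutive (sw b).
  move=> u; apply/ffunP => j; rewrite !ffunE; case: eqP => // _.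
  by rewrite tpermK.
transitivity (\sum_b \sum_u f u * (u k == b)%:R).
  rewrite mulr_natr -sumr_const; apply: eq_bigr => b _.
  rewrite (reindex_inj (inv_inj (swK b))) /=; apply: eq_bigr => u _.
  congr (_ * _); first by apply: fk => j /negPf jk; rewrite ffunE jk.
  by rewrite ffunE eqxx (can2_eq (tpermK _ _) (tpermK _ _)) tpermL.
rewrite exchange_big /=; apply: eq_bigr => u _.
rewrite (bigD1 (u k)) //= eqxx mulr1 big1 ?addr0 // => b /negPf bu.
by rewrite eq_sym bu mulr0.
Qed.

Variables (N : nat) (W : nat -> Q -> R) (G : nat -> Q -> Q) (sigma : R).

(** The decision closing phase [i] concerns phase [i.+1], hence the shift: phases below [N] play
    fresh draws, and later jumps need a bad value. *)
Definition hj_jump (i : nat) (x b : R) := (i.+1 < N)%N || (x < b - 2 * sigma).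

(* The current arm at the start of phase i and the best value seen so far. *)
Fixpoint hj_run (u : nat -> Q) (i : nat) : Q * R :=
  if i is i'.+1 then
    let: (q, b) := hj_run u i' in
    let b' := Num.max b (W i' q) in
    (if hj_jump i' (W i' q) b' then u i else G i' q, b')
  else (u 0%N, 0).

Let arm u i := (hj_run u i).1.
Let best u i := (hj_run u i).2.

Let bestS u i : best u i.+1 = Num.max (best u i) (W i (arm u i)).
Proof. by rewrite /best /arm /=; case: hj_run. Qed.

Let armS u i : arm u i.+1 =
  if hj_jump i (W i (arm u i)) (best u i.+1) then u i.+1 else G i (arm u i).
Proof. by rewrite bestS /best /arm /=; case: hj_run. Qed.

Let hj_run_ext u u' i : (forall j, (j <= i)%N -> u j = u' j) ->
  hj_run u i = hj_run u' i.
Proof.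
elim: i => [|i IH] h /=; first by rewrite h.
by rewrite IH ?h // => j ji; apply: h; rewrite leqW.
Qed.

(** In use, [a i] is what the best arm of the block has become by phase [i], [v] its average gain
    per phase, and [c] the phase length. To hit the best arm at phase [i] is to draw [a i]. *)
Variables (M : nat) (v c : R) (a : nat -> Q).
Hypothesis sigma_ge0 : 0 <= sigma.
Hypothesis v_ge0 : 0 <= v.
Hypothesis v_le : v <= c.
Hypothesis W_ge0 : forall i q, 0 <= W i q.
Hypothesis W_le : forall i q, (i < M)%N -> W i q <= v + sigma.
Hypothesis aS : forall i, a i.+1 = G i (a i).
Hypothesis W_a : forall i, (i < M)%N -> v - sigma <= W i (a i).

Let drop u i := W i (arm u i) < best u i.+1 - 2 * sigma.

Let best_le u i : (i <= M)%N -> best u i <= v + sigma.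
Proof.
elim: i => [|i IH] iM; first by rewrite addr_ge0.
by rewrite bestS ge_max IH ?W_le // ltnW.
Qed.

(** This fixes the threshold [2 * sigma]: the best value seen is at most [v + sigma], and the arm
    [a i] earns at least [v - sigma]. *)
Let a_nodrop u i : (i < M)%N -> arm u i = a i -> drop u i = false.
Proof.
move=> iM e; rewrite /drop e; apply/negbTE; rewrite -leNgt.
by have := W_a iM; have := best_le u iM; lra.
Qed.

Let stay u i j : (N <= i)%N -> (i <= j)%N -> (j <= M)%N -> arm u i = a i ->
  arm u j = a j.
Proof.
move=> Ni ij + e; rewrite -(subnKC ij); elim: (j - i)%N => [|d IH].
  by rewrite addn0.
rewrite addnS => dM; have {}IH := IH (ltnW dM).
rewrite armS /hj_jump ltnNge leqW ?(leq_trans Ni) ?leq_addr //=.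
by rewrite -/(drop u (i + d)) a_nodrop // IH aS.
Qed.

(** There are [M.+1] draws because the jump closing phase [M.-1] is counted too, and it reads
    [u M]. *)
Let ext (u : {ffun 'I_M.+1 -> Q}) i := u (inord i).

Let late_drop u i := (N <= i)%N && drop u i.

(** After a jump onto the best arm, the player follows it to the end of the block without any
    further drop. *)
Let hit_once u :
  \sum_(i < M) (late_drop u i && (u i.+1 == a i.+1))%:R <= 1 :> R.
Proof.
have [[i /andP[/andP[Ni di] /eqP ui]]|h] :=
  pselect (exists i : 'I_M, late_drop u i && (u i.+1 == a i.+1)); last first.
  rewrite big1 // => i _; case: (boolP (_ && _)) => // hi.
  by case: h; exists i.
have arm_a j : (i < j)%N -> (j <= M)%N -> arm u j = a j.
  move=> ij jM; apply: (stay (i := i.+1)) => //; first exact: leqW.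
  by rewrite armS /hj_jump -/(drop u i) di orbT.
have uniq_hit (j : 'I_M) : j != i ->
    late_drop u j && (u j.+1 == a j.+1) = false.
  rewrite neq_ltn => /orP[ji|ij]; last first.
    by rewrite /late_drop a_nodrop ?andbF // arm_a // ltnW.
  apply/negP => /andP[/andP[Nj dj] /eqP uj].
  suff e : arm u i = a i by move: di; rewrite (a_nodrop (ltn_ord i) e).
  apply: (stay (i := j.+1)) => //; [exact: leqW|exact: ltnW|].
  by rewrite armS /hj_jump -/(drop u j) dj orbT.
rewrite (bigD1 i) //= big1 ?addr0 ?lern1 ?leq_b1 // => j ji.
by rewrite uniq_hit.
Qed.

Let K := #|Q|.

Let K_gt0 : (0 < K)%N. Proof. by apply/card_gt0P; exists (a 0%N). Qed.

Let U := {ffun 'I_M.+1 -> Q}.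

(** A late drop at phase [i] depends only on the draws up to [i], so the next draw hits [a i.+1]
    with conditional probability [1 / K]. Expected drops are thus [K] times expected hits, and there
    is at most one hit. *)
Let sum_drops :
  \sum_(u : U) \sum_(i < M) (late_drop (ext u) i)%:R <= K%:R * #|U|%:R :> R.
Proof.
rewrite exchange_big /=.
have step (i : 'I_M) : \sum_(u : U) (late_drop (ext u) i)%:R =
    K%:R * \sum_(u : U) (late_drop (ext u) i && (ext u i.+1 == a i.+1))%:R :> R.
  have iM1 : (i.+1 < M.+1)%N by rewrite ltnS.
  have := @sum_indep _ (fun u : U => (late_drop (ext u) i)%:R : R)
    (Ordinal iM1) (a i.+1).
  under eq_bigr => u _ do rewrite -natrM mulnb.
  rewrite (_ : Ordinal iM1 = inord i.+1); last first.
    by apply: val_inj; rewrite /= inordK.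
  rewrite -/K => ->.
    by rewrite mulrC divfK // pnatr_eq0 -lt0n.
  move=> u u' uu'; rewrite /late_drop /drop.
  have e j : (j <= i)%N -> ext u j = ext u' j.
    move=> ji; apply: uu'; apply/eqP => /(congr1 val) /=.
    have jM : (j < M.+1)%N by rewrite ltnS (leq_trans ji) // ltnW.
    by rewrite !inordK // => jE; rewrite jE ltnn in ji.
  by rewrite !bestS /arm /best (hj_run_ext e).
under eq_bigr => i _ do rewrite step.
rewrite -mulr_sumr ler_wpM2l ?ler0n // exchange_big /=.
rewrite -[leRHS]sumr_const -/U; apply: ler_sum => u _; exact: hit_once.
Qed.

Let miss u m := all (fun i => u i != a i) (iota 0 m).

Let sum_miss m : (m <= M.+1)%N ->
  \sum_(u : U) (miss (ext u) m)%:R = #|U|%:R * (1 - K%:R^-1) ^+ m :> R.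
Proof.
elim: m => [_|m IH mM]; first by rewrite expr0 mulr1 sumr_const.
have := @sum_indep _ (fun u : U => (miss (ext u) m)%:R : R) (Ordinal mM) (a m).
rewrite (_ : Ordinal mM = inord m); last by apply: val_inj; rewrite /= inordK.
rewrite -/K => h.
rewrite exprSr mulrA -IH ?(ltnW mM) // mulrBr mulr1 -h.
  rewrite -sumrB; apply: eq_bigr => u _.
  rewrite /miss -[m.+1]addn1 iotaD all_cat /= andbT add0n -/(ext u m).
  by case: (all _ _); case: eqP; rewrite ?mulr1 ?mulr0 ?subr0 ?subrr.
move=> u u' uu'; congr (_%:R); congr nat_of_bool; apply: eq_in_all => j.
rewrite mem_iota add0n => /= jm; rewrite /ext uu' //.
apply/eqP => /(congr1 val) /=.
by rewrite !inordK ?(ltn_trans jm) // => jE; rewrite jE ltnn in jm.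
Qed.

Let best_mono u i j : (i <= j)%N -> best u i <= best u j.
Proof.
move=> /subnKC <-; elim: (j - i)%N => [|d IH]; first by rewrite addn0.
by rewrite addnS bestS le_max IH.
Qed.

(** If exploration met the best arm, the best value seen is at least [v - sigma], and an arm that is
    not dropped is within [2 * sigma] of it. In every other case a charge of [c >= v] makes the left
    side nonpositive. *)
Let value_ge u i : (i < M)%N ->
  v - 3 * sigma - c * ((i < N)%N%:R + (late_drop u i)%:R + (miss u N)%:R)
    <= W i (arm u i).
Proof.
move=> iM; have c0 : 0 <= c by exact: le_trans v_le.
have W0 := W_ge0 i (arm u i); have s0 := sigma_ge0.
have vc := v_le; have [iN|Ni] := ltnP i N.
  have : 0 <= c * ((late_drop u i)%:R + (miss u N)%:R).
    by rewrite mulr_ge0 // addr_ge0.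
  by move=> h0; rewrite mulr1n -(addrA 1) mulrDr mulr1; lra.
rewrite /late_drop Ni mulr0n add0r andTb; case: (boolP (drop u i)) => [_|].
  have : 0 <= c * (miss u N)%:R by rewrite mulr_ge0.
  by move=> h0; rewrite mulr1n mulrDr mulr1; lra.
rewrite mulr0n add0r -leNgt => nd.
case: (boolP (miss u N)) => [_|/allPn[j]]; first by rewrite mulr1n mulr1; lra.
rewrite mem_iota add0n /= => jN; rewrite negbK => /eqP uj.
have armj : arm u j = a j.
  rewrite -uj; case: (j) jN => [//|j' jN].
  by rewrite armS /hj_jump jN.
have : v - sigma <= best u i.+1.
  apply: (@le_trans _ _ (best u j.+1)); last first.
    by apply: best_mono; rewrite ltnS ltnW // (leq_trans jN).
  rewrite bestS le_max armj W_a ?orbT //.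
  by rewrite (ltn_trans _ iM) // (leq_trans jN).
by rewrite mulr0n mulr0; lra.
Qed.

(** In expectation, [value_ge] charges [N] exploring phases, at most [K] late drops, and all [M]
    phases when exploration misses. *)
Lemma hj_run_value : (N <= M)%N ->
  M%:R * (v - 3 * sigma) - c * (N%:R + K%:R + M%:R * (1 - K%:R^-1) ^+ N)
  <= (\sum_(u : U) \sum_(i < M) W i (hj_run (ext u) i).1) / #|U|%:R.
Proof.
move=> NM; have c0 : 0 <= c by exact: le_trans v_le.
have U0 : 0 < #|U|%:R :> R.
  by rewrite ltr0n; apply/card_gt0P; exists [ffun => a 0%N].
rewrite ler_pdivlMr //.
have h u : M%:R * (v - 3 * sigma) - c * (N%:R +
    \sum_(i < M) (late_drop u i)%:R + M%:R * (miss u N)%:R)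
    <= \sum_(i < M) W i (arm u i).
  apply: le_trans (ler_sum _ (fun (i : 'I_M) _ => value_ge u (ltn_ord i))).
  rewrite sumrB -mulr_sumr sumr_const card_ord -(mulr_natl (v - _)).
  rewrite !big_split /= sumr_const card_ord -(mulr_natl (miss u N)%:R).
  rewrite lerB // ler_wpM2l // !lerD2r.
  rewrite -(big_mkord xpredT (fun i => (i < N)%N%:R)).
  rewrite (big_cat_nat (leq0n N) NM) //=.
  rewrite big_mkord (eq_bigr (fun _ => 1)) ?sumr_const ?card_ord; last first.
    by move=> i _; rewrite ltn_ord.
  rewrite big_nat big1 ?addr0 // => i /andP[Ni _].
  by rewrite ltnNge Ni.
apply: le_trans (ler_sum _ (fun (u : U) _ => h (ext u))).
rewrite sumrB sumr_const -mulr_sumr !big_split /= sumr_const -mulr_sumr.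
rewrite sum_miss ?leqW //.
rewrite -(mulr_natl (M%:R * _)) -(mulr_natl N%:R).
rewrite mulrBl mulrC lerB // -mulrA ler_wpM2l // mulrDl mulrDl.
rewrite lerD // ?lerD //; first by rewrite mulrC.
by rewrite -mulrA [X in _ <= _ * X]mulrC.
Qed.

End HoldOrJump.

(** * The hold-or-jump rule as a machine acting round by round *)

Section BlockPlayer.
Variables (R : realType) (n : nat) (Q : finType).
Variables (act : Q -> 'I_n) (nxt : Q -> {i01 R} -> Q).
Variables (d M N : nat) (sigma : R) (u : nat -> Q).

(** The memory is reset after each block, and every block reuses the same draws [u]. This is
    harmless, since block gains are only added in expectation. *)
Record memory := Memory {
  position : nat ; phase : nat ; current : Q ; earned : R ; best_seen : R }.

Definition memory_start := Memory 0 0 (u 0%N) 0 0.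

Definition memory_next (x : memory) (y : {i01 R}) : memory :=
  let q := nxt (current x) y in
  let e := earned x + y%:num in
  if ((position x).+1 < d)%N
  then Memory (position x).+1 (phase x) q e (best_seen x)
  else if ((phase x).+1 < M)%N then
    let b := Num.max (best_seen x) e in
    Memory 0 (phase x).+1
      (if hj_jump N sigma (phase x) e b then u (phase x).+1 else q) 0 b
  else memory_start.

Let mem_act x := act (current x).

Variable r : rewards R n.

Let mrun := run mem_act memory_next r.
Let qrun := run act nxt r.
Let mgain := gain mem_act memory_next r.
Let qgain := gain act nxt r.

Let mrun_inner i q b t s : (s < d)%N ->
  mrun (Memory 0 i q 0 b) t s = Memory s i (qrun q t s) (qgain q t s) b.
Proof.
elim: s => [|s IH] sd; first by rewrite /qgain /gain big_ord0.
rewrite /mrun /= -/(mrun _ _ _) IH ?(ltn_trans _ sd) // /memory_next /= sd.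
by rewrite /qgain gainS.
Qed.

Hypothesis d_gt0 : (0 < d)%N.

Let mgain_phase i q b t : mgain (Memory 0 i q 0 b) t d = qgain q t d.
Proof.
apply: eq_bigr => s _; rewrite -/mrun mrun_inner //.
Qed.

Let mrun_phase i q b t : mrun (Memory 0 i q 0 b) t d =
  if (i.+1 < M)%N then
    let b' := Num.max b (qgain q t d) in
    Memory 0 i.+1
      (if hj_jump N sigma i (qgain q t d) b' then u i.+1 else qrun q t d) 0 b'
  else memory_start.
Proof.
have dE : d = d.-1.+1 by rewrite prednK.
have -> : mrun (Memory 0 i q 0 b) t d = mrun (Memory 0 i q 0 b) t d.-1.+1.
  by rewrite -dE.
rewrite /mrun [LHS]/= -/mrun mrun_inner ?prednK //.
rewrite /memory_next /= prednK // ltnn.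
have -> : qgain q t d = qgain q t d.-1 +
    (r (t + d.-1)%N (act (qrun q t d.-1)))%:num.
  by rewrite -gainS prednK.
suff -> : qrun q t d =
    nxt (qrun q t d.-1) (r (t + d.-1)%N (act (qrun q t d.-1))) by [].
by rewrite [in LHS]dE.
Qed.

Let W t i q := qgain q (t + i * d)%N d.
Let G t i q := qrun q (t + i * d)%N d.
Let hj t := hj_run N (W t) (G t) sigma u.

Let mrun_block t i : (i < M)%N ->
  mrun memory_start t (i * d) = Memory 0 i (hj t i).1 0 (hj t i).2.
Proof.
elim: i => [//|i IH] iM; rewrite mulSnr /mrun runD -/mrun IH ?(ltnW iM) //.
by rewrite mrun_phase iM /hj /=; case: (hj_run _ _ _ _ _ i).
Qed.

Hypothesis M_gt0 : (0 < M)%N.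

Let mrun_start t : mrun memory_start t (M * d) = memory_start.
Proof.
rewrite -{1}(prednK M_gt0) mulSnr /mrun runD -/mrun mrun_block ?prednK //.
by rewrite mrun_phase prednK // ltnn.
Qed.

Let mgain_block t :
  mgain memory_start t (M * d) = \sum_(i < M) W t i (hj t i).1.
Proof.
suff h i : (i <= M)%N ->
    mgain memory_start t (i * d) = \sum_(j < i) W t j (hj t j).1 by exact: h.
elim: i => [|i IH] iM; first by rewrite /mgain /gain !big_ord0.
rewrite mulSnr /mgain gainD -/mgain IH ?(ltnW iM) // big_ord_recr /=.
by congr (_ + _); rewrite -/mrun mrun_block // mgain_phase.
Qed.

Lemma block_player_gain nb : mgain memory_start 0 (nb * (M * d)) =
  \sum_(B < nb) \sum_(i < M)
    gain act nxt r
      (hj_run N (fun i q => gain act nxt r q (B * (M * d) + i * d) d)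
        (fun i q => run act nxt r q (B * (M * d) + i * d) d) sigma u i).1
      (B * (M * d) + i * d) d.
Proof.
have start_mul m : mrun memory_start 0 (m * (M * d)) = memory_start.
  elim: m => [//|m IH]; rewrite mulSnr /mrun runD -/mrun IH.
  exact: mrun_start.
elim: nb => [|nb IH]; first by rewrite /mgain /gain !big_ord0.
rewrite mulSnr /mgain gainD -/mgain IH big_ord_recr /=; congr (_ + _).
by rewrite -/mrun start_mul add0n mgain_block.
Qed.

End BlockPlayer.


(** * Expected gain on one block against its loss of energy *)

Section Potential.
Variables (R : realType) (n : nat) (Q : finType) (q0 : Q).
Variables (act : Q -> 'I_n) (nxt : Q -> {i01 R} -> Q) (r : rewards R n).

Let qgain := gain act nxt r.
Let qrun := run act nxt r.

Definition best_arm (t m : nat) : Q := [arg max_(q > q0) qgain q t m]%O.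

Definition best_gain (t m : nat) : R := qgain (best_arm t m) t m.

Lemma gain_le_best q t m : qgain q t m <= best_gain t m.
Proof. by rewrite /best_gain /best_arm; case: arg_maxP => // i _; apply. Qed.

Lemma best_gain_ge0 t m : 0 <= best_gain t m.
Proof. exact: gain_ge0. Qed.

Lemma best_gain_le t m : best_gain t m <= m%:R.
Proof. exact: gain_le. Qed.

Lemma gainM q t k d : qgain q t (k * d) =
  \sum_(i < k) qgain (qrun q t (i * d)) (t + i * d) d.
Proof.
elim: k => [|k IH]; first by rewrite /qgain /gain !big_ord0.
by rewrite mulSnr /qgain gainD -/qgain IH big_ord_recr.
Qed.

(* Deviations from [v], measured for the phase values of the best arm or for
   the best values of the phases, are both paid for by the loss of energy. *)
Lemma sum_sqr_dev (M : nat) (x y z : nat -> R) (v : R) :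
  0 <= v -> \sum_(i < M) x i = M%:R * v ->
  (forall i, (i < M)%N -> 0 <= x i <= y i) ->
  (forall i, (i < M)%N -> y i <= z i) ->
  \sum_(i < M) (y i - v) ^+ 2 <= \sum_(i < M) z i ^+ 2 - M%:R * v ^+ 2.
Proof.
move=> v0 xv xy yz.
have -> : M%:R * v ^+ 2 = 2 * v * (\sum_(i < M) x i) - \sum_(i < M) v ^+ 2.
  by rewrite xv sumr_const card_ord -[_ *+ M]mulr_natl; ring.
rewrite mulr_sumr -!sumrB; apply: ler_sum => i _.
have /andP[x0 xyi] := xy i (ltn_ord i); have yzi := yz i (ltn_ord i).
have h1 : y i ^+ 2 <= z i ^+ 2 by rewrite ler_pXn2r // nnegrE; lra.
have h2 : v * x i <= v * y i by rewrite ler_wpM2l.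
have -> : (y i - v) ^+ 2 = y i ^+ 2 - 2 * (v * y i) + v ^+ 2 by ring.
lra.
Qed.

Variables (d M N : nat).
Hypothesis M_gt0 : (0 < M)%N.
Hypothesis NM : (N <= M)%N.

Let K := #|Q|.
Let U := {ffun 'I_M.+1 -> Q}.
Let ext (u : U) i := u (inord i).
Let rho : R := (1 - K%:R^-1) ^+ N.

Let K_gt0 : (0 < K)%N. Proof. by apply/card_gt0P; exists q0. Qed.

Let rho_ge0 : 0 <= rho.
Proof. by rewrite exprn_ge0 // subr_ge0 invf_le1 ?ler1n ?ltr0n. Qed.

(** Two cases. If every phase is within [sigma] of the mean value [v], [hj_run_value] applies.
    Otherwise the loss of energy is so large that the claimed lower bound is nonpositive. *)
Lemma block_value (t : nat) (sigma : R) : 0 < sigma ->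
  best_gain t (M * d) - 3 * M%:R * sigma - d%:R * (N%:R + K%:R + M%:R * rho)
    - M%:R * d%:R / sigma ^+ 2 *
      (\sum_(i < M) best_gain (t + i * d) d ^+ 2
       - best_gain t (M * d) ^+ 2 / M%:R)
  <= (\sum_(u : U) \sum_(i < M)
        qgain (hj_run N (fun i q => qgain q (t + i * d)%N d)
          (fun i q => qrun q (t + i * d)%N d) sigma (ext u) i).1
          (t + i * d) d) / #|U|%:R.
Proof.
move=> s0; set a0 := best_arm t (M * d).
pose v := best_gain t (M * d) / M%:R.
pose a i := qrun a0 t (i * d).
pose x i := qgain (a i) (t + i * d) d.
pose z i := best_gain (t + i * d) d.
have M0 : 0 < M%:R :> R by rewrite ltr0n.
have bE : best_gain t (M * d) = M%:R * v by rewrite /v mulrC divfK // gt_eqF.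
have xv : \sum_(i < M) x i = M%:R * v by rewrite -bE /best_gain gainM.
have v0 : 0 <= v by rewrite divr_ge0 ?best_gain_ge0.
have vd : v <= d%:R.
  by rewrite /v ler_pdivrMr // mulrC -natrM best_gain_le.
have x0 i : 0 <= x i by apply: gain_ge0.
have xz i : x i <= z i by apply: gain_le_best.
set D := \sum_(i < M) _ - _.
have DE : D = \sum_(i < M) z i ^+ 2 - M%:R * v ^+ 2.
  by rewrite /D bE; congr (_ - _); field; rewrite gt_eqF.
have Dx : \sum_(i < M) (x i - v) ^+ 2 <= D.
  by rewrite DE; apply: (sum_sqr_dev v0 xv) => i _ //; rewrite x0 /=.
have Dz : \sum_(i < M) (z i - v) ^+ 2 <= D.
  by rewrite DE; apply: (sum_sqr_dev v0 xv) => i _ //; rewrite x0 xz.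
have D0 : 0 <= D by apply: le_trans Dx; apply: sumr_ge0 => i _; apply: sqr_ge0.
have coef0 : 0 <= M%:R * d%:R / sigma ^+ 2.
  by rewrite divr_ge0 ?sqr_ge0 ?mulr_ge0 ?ler0n.
have [good|bad] := pselect (forall i, (i < M)%N ->
    z i <= v + sigma /\ v - sigma <= x i).
  have H := @hj_run_value R Q N (fun i q => qgain q (t + i * d)%N d)
    (fun i q => qrun q (t + i * d)%N d) sigma M v d%:R a.
  apply: le_trans (H _ _ _ _ _ _ _ _) => //.
  - have : 0 <= M%:R * d%:R / sigma ^+ 2 * D by rewrite mulr_ge0.
    by rewrite bE -/K -/rho; lra.
  - exact: ltW.
  - by move=> i q; apply: gain_ge0.
  - by move=> i q /good[+ _]; apply: le_trans; apply: gain_le_best.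
  - by move=> i; rewrite /a mulSnr /qrun runD.
  - by move=> i /good[].
(* A single failing phase already contributes [sigma ^+ 2] to one of the two sums of squared
   deviations. *)
have Ds : sigma ^+ 2 <= D.
  have /existsNP[i /not_implyP[iM]] := bad.
  have term (y : nat -> R) : sigma ^+ 2 <= (y i - v) ^+ 2 ->
      \sum_(j < M) (y j - v) ^+ 2 <= D -> sigma ^+ 2 <= D.
    move=> h; apply: le_trans; apply: (le_trans h).
    rewrite (bigD1 (Ordinal iM)) //= lerDl.
    by apply: sumr_ge0 => j _; apply: sqr_ge0.
  move=> /not_andP[/negP|/negP]; rewrite -ltNge => h.
    apply: (term z) => //; rewrite ler_pXn2r // ?nnegrE; lra.
  apply: (term x) => //; rewrite -[leRHS]sqrrN ler_pXn2r // ?nnegrE; lra.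
(* As [D >= sigma ^+ 2], the energy term is at least [M * d], the largest possible gain of a
   block. *)
apply: (@le_trans _ _ 0); last first.
  rewrite divr_ge0 // sumr_ge0 // => u _; apply: sumr_ge0 => i _.
  exact: gain_ge0.
have h1 : M%:R * d%:R <= M%:R * d%:R / sigma ^+ 2 * D.
  by rewrite mulrAC ler_pdivlMr ?exprn_gt0 // ler_wpM2l // mulr_ge0.
have h2 : M%:R * v <= M%:R * d%:R by rewrite ler_wpM2l.
have h3 : 0 <= d%:R * (N%:R + K%:R + M%:R * rho).
  by rewrite mulr_ge0 // !addr_ge0 // mulr_ge0.
have h4 : 0 <= 3 * M%:R * sigma by rewrite !mulr_ge0 // ltW.
by rewrite bE; lra.
Qed.

End Potential.

(** * Averaging over scales by telescoping the energy *)

Section Scales.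
Variables (R : realType) (n : nat) (Q : finType) (q0 : Q).
Variables (act : Q -> 'I_n) (nxt : Q -> {i01 R} -> Q).

Lemma sum_mul_nat (nb M : nat) (f : nat -> R) :
  \sum_(b < nb * M) f b = \sum_(B < nb) \sum_(i < M) f (B * M + i)%N.
Proof.
elim: nb => [|nb IH]; first by rewrite !big_ord0.
by rewrite mulSnr big_split_ord /= IH big_ord_recr.
Qed.

Variable r : rewards R n.

Let qgain := gain act nxt r.
Let best := best_gain q0 act nxt r.

(** The squares of the mean values [best / m], weighted by the block length [m], so that tilings of
    the same rounds at different scales are comparable. *)
Definition energy (nb m : nat) : R :=
  \sum_(B < nb) best (B * m) m ^+ 2 / m%:R.

Let energy_ge0 nb m : 0 <= energy nb m.
Proof. by apply: sumr_ge0 => B _; rewrite divr_ge0 ?sqr_ge0. Qed.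

Let energy1 nb : energy nb 1 <= nb%:R.
Proof.
rewrite -[nb in leRHS]card_ord -sumr_const; apply: ler_sum => B _.
rewrite divr1 expr_le1 ?best_gain_ge0 //.
exact: (best_gain_le _ _ _ _ _ 1).
Qed.

Variables (M N : nat) (tau : R).
Hypothesis M_gt0 : (0 < M)%N.
Hypothesis NM : (N <= M)%N.
Hypothesis tau_gt0 : 0 < tau.

Let K := #|Q|.
Let U := {ffun 'I_M.+1 -> Q}.
Let ext (u : U) i := u (inord i).

Let loss : R := 3 * tau + (N + K)%:R / M%:R + (1 - K%:R^-1) ^+ N.

Definition scale_player_gain (d : nat) (u : U) (T : nat) : R :=
  gain (fun x : memory R Q => act (current x))
    (memory_next nxt d M N (tau * d%:R) (ext u)) r (memory_start R (ext u)) 0 T.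

Let U_gt0 : 0 < #|U|%:R :> R.
Proof. by rewrite ltr0n; apply/card_gt0P; exists [ffun => q0]. Qed.

(** [block_value] is summed over the blocks with [sigma = tau * d]. A fixed arm is at most the best
    arm on each block, and the deficits add up to the energy lost from length [d] to length
    [M * d]. *)
Lemma scale_value (d nb T : nat) q : (0 < d)%N -> (nb * (M * d) <= T)%N ->
  qgain q 0 (nb * (M * d)) - (nb * (M * d))%:R * loss
    - M%:R / tau ^+ 2 * (energy (nb * M) d - energy nb (M * d))
  <= (\sum_u scale_player_gain d u T) / #|U|%:R.
Proof.
move=> d0 HT.
have dR : 0 < d%:R :> R by rewrite ltr0n.
have MR : 0 < M%:R :> R by rewrite ltr0n.
apply: (@le_trans _ _
  ((\sum_u scale_player_gain d u (nb * (M * d))) / #|U|%:R)); last first.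
  by rewrite ler_pM2r ?invr_gt0 //; apply: ler_sum => u _; apply: gain_mono.
rewrite /scale_player_gain.
under eq_bigr => u _ do rewrite block_player_gain //.
rewrite exchange_big /= mulr_suml.
have sigma0 : 0 < tau * d%:R by rewrite mulr_gt0.
apply: le_trans (ler_sum _ (fun (B : 'I_nb) _ =>
  block_value q0 act nxt r d M_gt0 NM (B * (M * d)) sigma0)).
rewrite !sumrB !sumr_const card_ord -mulr_sumr sumrB.
have -> : energy (nb * M) d = \sum_(B < nb)
    (\sum_(i < M) best (B * (M * d) + i * d) d ^+ 2) / d%:R.
  rewrite /energy (sum_mul_nat nb M (fun b => best (b * d) d ^+ 2 / d%:R)).
  apply: eq_bigr => B _; rewrite mulr_suml; apply: eq_bigr => i _.
  by rewrite mulnDl mulnA.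
rewrite -mulr_suml /energy.
have hq : qgain q 0 (nb * (M * d)) <=
    \sum_(B < nb) best (B * (M * d)) (M * d).
  rewrite /qgain gainM; apply: ler_sum => B _; rewrite add0n.
  exact: gain_le_best.
have e2 : \sum_(B < nb) best (B * (M * d)) (M * d) ^+ 2 / (M * d)%:R =
    (\sum_(B < nb) best (B * (M * d)) (M * d) ^+ 2 / M%:R) / d%:R.
  rewrite [RHS]mulr_suml; apply: eq_bigr => B _.
  by rewrite natrM invfM mulrA.
rewrite e2; set S1 := \sum_(i < nb) \sum_(j < M) _.
set S2 := \sum_(i < nb) _ / M%:R.
rewrite -(mulr_natl (3 * _ * _) nb) -(mulr_natl (d%:R * _) nb).
set P := \sum_(i < nb) _ in hq *.
have -> : (nb * (M * d))%:R * loss = nb%:R * (3 * M%:R * (tau * d%:R)) +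
  nb%:R * (d%:R * (N%:R + K%:R + M%:R * (1 - K%:R^-1) ^+ N)).
  rewrite /loss !natrM natrD; field; by rewrite gt_eqF.
have -> : M%:R / tau ^+ 2 * (S1 / d%:R - S2 / d%:R) =
  M%:R * d%:R / (tau * d%:R) ^+ 2 * (S1 - S2).
  field; by rewrite !gt_eqF.
rewrite -/K; lra.
Qed.

(** The energy losses at scales [j < J] telescope to at most the energy of single rounds, which is
    at most [T]. A uniformly random scale thus pays only a [1 / J] share of it. *)
Lemma averaged_value (J T : nat) q : (0 < J)%N ->
  qgain q 0 T - (M ^ J)%:R - T%:R * (loss + M%:R / (tau ^+ 2 * J%:R))
  <= (\sum_(w : 'I_J * U) scale_player_gain (M ^ w.1) w.2 T)
       / #|{: 'I_J * U}|%:R.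
Proof.
(* [H] is the largest multiple of [M ^ J] up to [T], so that all scales tile the same [H] rounds;
   the remainder costs less than [M ^ J]. *)
move=> J0; pose c := (T %/ M ^ J)%N; pose H := (c * M ^ J)%N.
have JR : 0 < J%:R :> R by rewrite ltr0n.
have t2 : 0 < tau ^+ 2 by rewrite exprn_gt0.
have HT : (H <= T)%N by exact: leq_divM.
pose En j := energy (c * M ^ (J - j)) (M ^ j).
have step (j : 'I_J) : qgain q 0 H - H%:R * loss -
    M%:R / tau ^+ 2 * (En j - En j.+1)
    <= (\sum_u scale_player_gain (M ^ j) u T) / #|U|%:R.
  have jJ := ltn_ord j.
  pose nb := (c * M ^ (J - j.+1))%N.
  have HE : (nb * (M * M ^ j) = H)%N.
    by rewrite /nb -expnS -mulnA -expnD subnK.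
  have d0 : (0 < M ^ j)%N by rewrite expn_gt0 M_gt0.
  have HT' : (nb * (M * M ^ j) <= T)%N by rewrite HE.
  have := scale_value q d0 HT'.
  by rewrite HE -expnS {1}/nb -mulnA -expnSr subnSK.
have sumE : J%:R * (qgain q 0 H - H%:R * loss) - M%:R / tau ^+ 2 * H%:R <=
    \sum_(j < J) (\sum_u scale_player_gain (M ^ j) u T) / #|U|%:R.
  apply: le_trans (ler_sum _ (fun (j : 'I_J) _ => step j)).
  rewrite sumrB sumr_const card_ord -mulr_sumr mulr_natl lerB //.
  rewrite ler_wpM2l ?divr_ge0 ?(ltW t2) //.
  have -> : \sum_(j < J) (En j - En j.+1) = En 0%N - En J.
    rewrite -[RHS]opprB -telescope_sumr // -sumrN big_mkord.
    by apply: eq_bigr => j _; rewrite opprB.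
  have := energy_ge0 (c * M ^ (J - J)) (M ^ J).
  have -> : En 0%N = energy H 1 by rewrite /En subn0 expn0.
  by have := energy1 H; rewrite -/(En J); lra.
have <- : \sum_(j < J) (\sum_u scale_player_gain (M ^ j) u T) / #|U|%:R / J%:R =
    (\sum_(w : 'I_J * U) scale_player_gain (M ^ w.1) w.2 T)
      / #|{: 'I_J * U}|%:R.
  rewrite -!mulr_suml pair_bigA /= card_prod card_ord natrM invfM.
  by rewrite -mulrA [X in _ * X]mulrC.
rewrite -mulr_suml ler_pdivlMr //; apply: le_trans sumE.
have HTR : H%:R <= T%:R :> R by rewrite ler_nat.
have hT : qgain q 0 T <= qgain q 0 H + (M ^ J)%:R.
  rewrite -(subnKC HT) /qgain gainD lerD2l.
  apply: le_trans (gain_le _ _ _ _ _ _) _.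
  rewrite ler_nat ltnW // {1}(divn_eq T (M ^ J)) addKn ltn_mod expn_gt0.
  by rewrite M_gt0.
have K0 : (0 < K)%N by apply/card_gt0P; exists q0.
have loss0 : 0 <= loss.
  rewrite /loss !addr_ge0 ?mulr_ge0 ?(ltW tau_gt0) ?invr_ge0 //.
  by rewrite exprn_ge0 // subr_ge0 invf_le1 ?ler1n ?ltr0n.
have h1 : H%:R * loss <= T%:R * loss by rewrite ler_wpM2r.
have h2 : M%:R / tau ^+ 2 * H%:R <= M%:R / tau ^+ 2 * T%:R.
  by rewrite ler_wpM2l // divr_ge0 // (ltW t2).
have -> : (qgain q 0 T - (M ^ J)%:R - T%:R * (loss + M%:R / (tau ^+ 2 * J%:R)))
   * J%:R = J%:R * (qgain q 0 T - (M ^ J)%:R - T%:R * loss)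
     - M%:R / tau ^+ 2 * T%:R.
  by field; rewrite !gt_eqF.
by rewrite lerB // ler_wpM2l ?(ltW JR) //; lra.
Qed.

End Scales.

(** * Regret against policies and choice of the parameters *)

(** An arm keeps its policy index and moves only its state, so the arm at the initial state of a
    policy earns exactly that policy's reward. The seed consists of a scale and the [M.+1] draws. *)
Lemma regret_player (R : realType) (n S k : nat) (Pi : reference_set R n S k)
    (M N J : nat) (tau : R) :
  (0 < k)%N -> (0 < S)%N -> (0 < M)%N -> (N <= M)%N -> (0 < J)%N -> 0 < tau ->
  exists p : player R n, forall (r : rewards R n) (T : nat),
    regret Pi p r T <= (M ^ J)%:R + T%:R *
      (3 * tau + (N + k * S)%:R / M%:R + (1 - (k * S)%:R^-1) ^+ N
       + M%:R / (tau ^+ 2 * J%:R)).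
Proof.
move=> k0 S0 M0 NM J0 tau0.
pose ps := Tuple (valP Pi : size (enum_fset (sval Pi)) == k).
pose Q : finType := ('I_k * 'I_S)%type.
pose q0 : Q := (Ordinal k0, Ordinal S0).
have cQ : #|Q| = (k * S)%N by rewrite card_prod !card_ord.
pose act (q : Q) := action_of (tnth ps q.1) q.2.
pose nxt (q : Q) y : Q := (q.1, next_state (tnth ps q.1) q.2 y).
pose W : finType := ('I_J * {ffun 'I_M.+1 -> Q})%type.
pose ext (u : {ffun 'I_M.+1 -> Q}) i := u (inord i).
have [p pE] := @mixture_player R n (memory R Q) W (Ordinal J0, [ffun => q0])
  (fun x => act (current x))
  (fun w => memory_next nxt (M ^ w.1) M N (tau * (M ^ w.1)%:R) (ext w.2))
  (fun w => memory_start R (ext w.2)).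
exists p => r T; rewrite /regret lerBlDr pE.
have value := averaged_value q0 act nxt r M0 NM tau0 T _ J0.
have gainE i : gain act nxt r (i, init_state (tnth ps i)) 0 T =
    policy_reward (tnth ps i) r T.
  have runE t : run act nxt r (i, init_state (tnth ps i)) 0 t =
      (i, policy_state (tnth ps i) r t).
    by elim: t => [//|t IH] /=; rewrite IH.
  by apply: eq_bigr => t _; rewrite runE.
rewrite -/W in value; set E := (X in _ <= _ + X).
have bound i : policy_reward (tnth ps i) r T <= (M ^ J)%:R + T%:R *
      (3 * tau + (N + k * S)%:R / M%:R + (1 - (k * S)%:R^-1) ^+ N
       + M%:R / (tau ^+ 2 * J%:R)) + E.
  have := value (i, init_state (tnth ps i)); rewrite gainE cQ -[leRHS]/E.
  by lra.
(* The default 0 of the maximum lies below the reward of the first policy, hence below the bound. *)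
rewrite big_seq; apply: bigmax_le => [|pi pi_in].
  apply: le_trans (bound (Ordinal k0)).
  by apply: sumr_ge0 => t _; apply: ge0.
have /tnthP[i ->] : pi \in ps by [].
exact: bound.
Qed.

Lemma regret_le_rounds (R : realType) (n S k : nat)
    (Pi : reference_set R n S k) (p : player R n) (r : rewards R n) T :
  regret Pi p r T <= T%:R.
Proof.
rewrite /regret lerBlDr.
have E0 : 0 <= expected_reward p r T.
  apply: sumr_ge0 => x _; rewrite mulr_ge0 ?prodr_ge0 //.
    by move=> t _; apply: Defs.pmf_ge0.
  by apply: sumr_ge0 => t _; apply: ge0.
apply: bigmax_le => [|pi _]; first by rewrite addr_ge0.
apply: (@le_trans _ _ T%:R); last by rewrite lerDl.
rewrite -[T in leRHS]card_ord -sumr_const.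
by apply: ler_sum => i _; apply: le1.
Qed.

Lemma expr_le_expR (R : realType) (K N : nat) : (0 < K)%N ->
  (1 - K%:R^-1) ^+ N <= expR (- (N%:R / K%:R)) :> R.
Proof.
move=> K0; rewrite -mulrN expRM_natl lerXn2r ?nnegrE ?expR_ge0 //.
  by rewrite subr_ge0 invf_le1 ?ler1n ?ltr0n.
exact: expR_ge1Dx.
Qed.

Lemma truncnS_bounds (R : realType) (x : R) : 1 <= x ->
  x <= (Num.truncn x).+1%:R <= 2 * x.
Proof.
move=> x1; have x0 : 0 <= x by lra.
have /andP[h1 h2] := truncn_itv x0.
by rewrite (ltW h2) -natr1 /=; lra.
Qed.

(* The parameters are [y = (ln T)^(1/4)] and [l = ln (ln T)]. *)
Lemma tuned_regret (R : realType) (n S k : nat) (Pi : reference_set R n S k)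
    (T : nat) (y l : R) :
  (0 < k)%N -> (0 < S)%N -> 3 <= y -> 1 <= l -> l <= 4 * y ->
  expR l = y ^+ 4 -> expR (y ^+ 4) = T%:R ->
  exists p : player R n, forall r : rewards R n,
    regret Pi p r T <= 15 * (Num.sqrt (k * S)%:R * l / y) * T%:R.
Proof.
move=> k0 S0 y3 l1 ly lE TE; pose K := (k * S)%N.
have K0 : (0 < K)%N by rewrite muln_gt0 k0.
set s := Num.sqrt _; set eps := s * l / y.
have y0 : 0 < y by lra.
have l0 : 0 < l by lra.
have T0 : 0 <= T%:R :> R by [].
have s2 : s ^+ 2 = K%:R by rewrite sqr_sqrtr.
have s1 : 1 <= s by rewrite -sqrtr1 ler_wsqrtr // ler1n.
have s0 : 0 < s by lra.
have e0 : 0 < eps by rewrite divr_gt0 // mulr_gt0.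
(* For [eps >= 1] the trivial bound [T] suffices for any player. *)
have [e1|e1] := leP 1 eps.
  have [p _] := @regret_player R n S k Pi 1 0 1 1 k0 S0 isT isT isT ltr01.
  exists p => r; apply: le_trans (regret_le_rounds Pi p r T) _.
  by rewrite ler_peMl //; lra.
have epsy : eps * y = s * l by rewrite /eps divfK // gt_eqF.
(* With [N = K * a], exploration misses with probability at most [expR (- l)]; with [M = N * m], it
   takes at most a fraction [eps] of the phases. *)
pose a := (Num.truncn l).+1; pose m := (Num.truncn eps^-1).+1.
have /andP[al al2] := truncnS_bounds l1.
have ie1 : 1 <= eps^-1 by rewrite invf_ge1 // ltW.
have /andP[me me2] := truncnS_bounds ie1.
rewrite -/a -/m in al al2 me me2.
pose N := (K * a)%N; pose M := (N * m)%N.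
have N0 : (0 < N)%N by rewrite muln_gt0 K0.
have M0 : (0 < M)%N by rewrite muln_gt0 N0.
have ysM : M%:R <= 4 * y * s.
  have -> : M%:R = s ^+ 2 * (a%:R * m%:R) :> R by rewrite s2 !natrM mulrA.
  have h : a%:R * m%:R <= (2 * l) * (2 * eps^-1) :> R.
    by apply: ler_pM.
  apply: (@le_trans _ _ (s ^+ 2 * (2 * l * (2 * eps^-1)))).
    by rewrite ler_wpM2l // sqr_ge0.
  have -> : s ^+ 2 * (2 * l * (2 * eps^-1)) = 4 * y * s.
    by rewrite /eps; field; rewrite !gt_eqF.
  by [].
have y2M : M%:R <= 4 * y ^+ 2.
  apply: le_trans ysM _.
  have : s * 1 <= s * l by rewrite ler_pM2l.
  have : eps * y <= 1 * y by rewrite ler_pM2r // ltW.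
  by rewrite epsy => h1 h2; rewrite expr2 mulrA ler_pM2l ?mulr_gt0 //; lra.
have y4 : 16 * y <= y ^+ 4.
  have : 3 * 3 * 3 <= y * y * y by rewrite !ler_pM // ?mulr_ge0 //; lra.
  rewrite (_ : y ^+ 4 = y * y * y * y); last by ring.
  by move=> h; rewrite ler_pM2r //; lra.
have ML : M%:R <= expR l.
  rewrite lE; apply: le_trans y2M _.
  rewrite (_ : y ^+ 4 = y * y * y ^+ 2); last by ring.
  rewrite ler_pM2r ?exprn_gt0 //.
  have : 3 * 3 <= y * y by rewrite ler_pM //; lra.
  lra.
(* Here [x] is [ln T / ln (ln T)], so [M <= expR l = ln T] gives [M ^ J.+1 <= T]. Stopping at [J],
   one below the integer part of [x], spares a factor [M >= 1 / eps], whence [M ^ J <= eps * T]. *)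
pose x := y ^+ 4 / l.
have x4 : 4 <= x by rewrite ler_pdivlMr //; lra.
pose J := (Num.truncn x).-1.
have /andP[Jx xJ] := truncn_itv (le_trans (ler0n R 4) x4).
have t2 : (2 < Num.truncn x)%N.
  by rewrite -(ltr_nat R); move: xJ; rewrite -natr1; lra.
have JE : Num.truncn x = J.+1 by rewrite /J prednK // (ltn_trans _ t2).
have J0 : (0 < J)%N by rewrite -ltnS -JE ltnW.
rewrite JE in Jx xJ.
have xJ2 : x <= 2 * J%:R by move: xJ; rewrite -!natr1; lra.
have NM : (N <= M)%N by rewrite leq_pmulr.
have [p pE] := @regret_player R n S k Pi M N J eps k0 S0 M0 NM J0 e0.
exists p => r; apply: le_trans (pE r T) _; rewrite -/K.
have mM : m%:R <= M%:R :> R by rewrite ler_nat leq_pmull.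
have MR : 0 < M%:R :> R by rewrite ltr0n.
have h1 : (M ^ J)%:R <= eps * T%:R.
  have MJ : (M ^ J.+1)%:R <= T%:R :> R.
    rewrite natrX -TE; apply: (@le_trans _ _ (expR l ^+ J.+1)).
      by rewrite lerXn2r ?nnegrE ?expR_ge0.
    rewrite -expRM_natl ler_expR.
    by rewrite -ler_pdivlMr.
  have : 1 <= eps * M%:R.
    rewrite mulrC -ler_pdivrMr // div1r; exact: le_trans mM.
  move=> /(ler_wpM2l (ler0n R (M ^ J))); rewrite mulr1 => /le_trans; apply.
  rewrite mulrCA ler_pM2l // -natrM; by rewrite expnSr in MJ.
have h2 : (N + K)%:R / M%:R <= 2 * eps.
  rewrite ler_pdivrMr //.
  have NK : (N + K)%:R <= 2 * N%:R :> R.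
    by rewrite -natrM ler_nat mul2n -addnn leq_add2l leq_pmulr.
  apply: le_trans NK _; rewrite -mulrA ler_pM2l // /M natrM mulrCA.
  rewrite ler_peMr //.
  by rewrite mulrC -ler_pdivrMr // div1r.
have h3 : (1 - K%:R^-1) ^+ N <= eps.
  apply: le_trans (expr_le_expR R N K0) _.
  have -> : N%:R / K%:R = a%:R :> R.
    by rewrite /N natrM mulrAC divff ?mul1r // pnatr_eq0 -lt0n.
  apply: (@le_trans _ _ (expR (- l))); first by rewrite ler_expR lerN2.
  rewrite expRN lE /eps -[leLHS]mul1r ler_pM ?invr_ge0 ?exprn_ge0 ?(ltW y0) //.
    by rewrite -[1]mulr1 ler_pM.
  rewrite lef_pV2 ?posrE ?exprn_gt0 //; lra.
(* This term dictates the fourth root: with [M] of order [y * s] and [J] of order [y ^+ 4 / l], it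
   asks that [eps ^+ 3 * x] be at least [y * s]. *)
have h4 : M%:R / (eps ^+ 2 * J%:R) <= 8 * eps.
  have JR : 0 < J%:R :> R by rewrite ltr0n.
  have den0 : 0 < eps ^+ 2 * J%:R by apply: mulr_gt0 => //; apply: exprn_gt0.
  rewrite ler_pdivrMr //.
  apply: le_trans ysM _.
  have -> : 8 * eps * (eps ^+ 2 * J%:R) = 4 * (eps ^+ 3 * (2 * J%:R)) by ring.
  rewrite -mulrA ler_pM2l //; apply: (@le_trans _ _ (eps ^+ 3 * x)); last first.
    by rewrite ler_pM2l ?exprn_gt0.
  have -> : eps ^+ 3 * x = (y * s) * ((s * l) * (s * l)).
    by rewrite /x /eps; field; rewrite !gt_eqF.
  have sl : 1 <= s * l by rewrite -[leLHS]mulr1 ler_pM.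
  have sl2 : 1 <= s * l * (s * l) by rewrite -[leLHS]mulr1 ler_pM.
  by rewrite ler_peMr // mulr_ge0 // ltW.
(* The constant is 15 = 1 + 3 + 2 + 1 + 8: the rounds left over, then the four terms of the loss per
   round. *)
have -> : 15 * eps * T%:R =
    eps * T%:R + T%:R * (3 * eps + 2 * eps + eps + 8 * eps) by ring.
by rewrite lerD // ler_wpM2l // !lerD.
Qed.

(** The bound 81 is [3 ^+ 4], for the fourth root to be at least 3; [expR 1 <= L0] makes the
    iterated logarithm at least 1. *)
Lemma tuned_asymptotics (R : realType) (T : nat) (L0 : R) : 81 <= L0 ->
  expR 1 <= L0 -> expR L0 <= T%:R ->
  [/\ 3 <= ln T%:R `^ 4^-1 :> R, 1 <= ln (ln T%:R) :> R,
      ln (ln T%:R) <= 4 * (ln T%:R `^ 4^-1) :> R,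
      expR (ln (ln T%:R)) = (ln T%:R `^ 4^-1) ^+ 4 :> R &
      expR ((ln T%:R `^ 4^-1) ^+ 4) = T%:R :> R].
Proof.
move=> L81 Le LT; set L := ln T%:R : R; set y := L `^ 4^-1.
have T0 : 0 < T%:R :> R by apply: lt_le_trans LT; apply: expR_gt0.
have LL : L0 <= L by rewrite -ler_expR lnK ?posrE.
have L0' : 0 < L by lra.
have y0 : 0 < y by apply: powR_gt0.
have yE : y ^+ 4 = L.
  by rewrite -powR_mulrn ?(ltW y0) // -powRrM mulVf // powRr1 // ltW.
split; rewrite ?yE.
- rewrite leNgt; apply/negP => y3.
  have : y ^+ 4 < 3 ^+ 4 by rewrite ltrXn2r // ?nnegrE ?(ltW y0).
  by rewrite yE; lra.
- by rewrite -ler_expR lnK ?posrE //; lra.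
- have -> : ln L = 4 * ln y by rewrite ln_powR mulrA mulfV ?mul1r.
  by rewrite ler_pM2l // ltW // ln_sublinear.
- by rewrite lnK ?posrE.
- by rewrite lnK ?posrE.
Qed.

(** With [z] the eighth root of [L], the ratio is [8 * ln z / z ^+ 2], at most [8 / z]. *)
Lemma loglog_ratio_le (R : realType) (L e : R) : 0 < e -> (8 / e) ^+ 8 <= L ->
  ln L / L `^ 4^-1 <= e.
Proof.
move=> e0 eL; set z := L `^ 8^-1.
have b0 : 0 < 8 / e by rewrite divr_gt0.
have L0 : 0 < L by apply: lt_le_trans eL; rewrite exprn_gt0.
have z0 : 0 < z by apply: powR_gt0.
have zE : z ^+ 8 = L.
  by rewrite -powR_mulrn ?(ltW z0) // -powRrM mulVf // powRr1 // ltW.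
have -> : L `^ 4^-1 = z ^+ 2.
  by rewrite -powR_mulrn ?(ltW z0) // -powRrM; congr (_ `^ _); field.
have -> : ln L = 8 * ln z by rewrite ln_powR mulrA mulfV ?mul1r.
have bz : 8 / e <= z.
  rewrite leNgt; apply/negP => h.
  have : z ^+ 8 < (8 / e) ^+ 8.
    by rewrite ltrXn2r // ?nnegrE ?(ltW z0) ?(ltW b0).
  by rewrite zE ltNge eL.
rewrite ler_pdivrMr ?exprn_gt0 //.
apply: (@le_trans _ _ (8 * z)).
  by rewrite ler_pM2l // ltW // ln_sublinear.
by rewrite expr2 mulrA ler_pM2r // mulrC -ler_pdivrMr.
Qed.

Local Open Scope classical_set_scope.

Theorem theorem3 (R : realType) :
  exists (C : R) (T0 : nat), 0 < C /\ (0 < T0)%N /\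
  forall k S : nat, (1 <= k)%N -> (1 <= S)%N ->
  exists A : algorithm R k S,
    (forall (n : nat) (Pi : reference_set R n S k) (T : nat), (T0 <= T)%N ->
     forall r : rewards R n,
       regret Pi (A n Pi T) r T <=
         C * Num.sqrt (k * S)%:R *
         (T%:R * ln (ln T%:R) / (ln T%:R `^ 4^-1))) /\
    (forall eps : R, 0 < eps ->
     \forall T \near \oo,
       forall (n : nat) (Pi : reference_set R n S k) (r : rewards R n),
         regret Pi (A n Pi T) r T <= eps * T%:R).
Proof.
pose L0 : R := 81 + expR 1; pose T0 := (Num.truncn (expR L0)).+1.
exists 15, T0; split => //; split => // k S k1 S1.
pose bound (T : nat) : R := 15 * Num.sqrt (k * S)%:R *
  (T%:R * ln (ln T%:R) / (ln T%:R `^ 4^-1)).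
(* The condition [T0 <= T] stands inside the existential, so that a player can be chosen for every
   input; below [T0] any player will do. *)
have tuned n (Pi : reference_set R n S k) T : exists p : player R n,
    (T0 <= T)%N -> forall r, regret Pi p r T <= bound T.
  have [TT|_] := leqP T0 T; last first.
    have [p _] := @regret_player R n S k Pi 1 0 1 1 k1 S1 isT isT isT ltr01.
    by exists p.
  have e1 : 0 <= expR 1 :> R by apply: expR_ge0.
  have LT : expR L0 <= T%:R :> R.
    by apply/ltW/(lt_le_trans (truncnS_gt _)); rewrite ler_nat.
  have [||y3 l1 ly lE TE] := @tuned_asymptotics R T L0 _ _ LT.
  - by rewrite /L0; lra.
  - by rewrite /L0; lra.
  have [p pE] := tuned_regret Pi k1 S1 y3 l1 ly lE TE.
  exists p => _ r; apply: le_trans (pE r) _; rewrite /bound le_eqVlt.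
  by apply/orP; left; apply/eqP; rewrite -!mulrA; congr (_ * (_ * _)); ring.
pose A : algorithm R k S := fun n Pi T => projT1 (cid (tuned n Pi T)).
have AE n Pi T : (T0 <= T)%N -> forall r, regret Pi (A n Pi T) r T <= bound T.
  exact: projT2 (cid (tuned n Pi T)).
exists A; split => [n Pi T TT r|eps eps0]; first exact: AE.
pose c : R := 15 * Num.sqrt (k * S)%:R.
have c0 : 0 < c by rewrite mulr_gt0 // sqrtr_gt0 ltr0n muln_gt0 k1.
pose e := eps / c; have e0 : 0 < e by rewrite divr_gt0.
(* From [T1] on, [ln T] exceeds the threshold of [loglog_ratio_le] for [e]. *)
pose T1 := (Num.truncn (expR ((8 / e) ^+ 8))).+1.
exists (maxn T0 T1) => // T /=; rewrite geq_max => /andP[TT0 TT1] n Pi r.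
apply: le_trans (AE n Pi T TT0 r) _.
have LT : expR ((8 / e) ^+ 8) <= T%:R :> R.
  by apply/ltW/(lt_le_trans (truncnS_gt _)); rewrite ler_nat.
have Tpos : 0 < T%:R :> R by apply: lt_le_trans LT; apply: expR_gt0.
have : ln (ln T%:R) / (ln T%:R `^ 4^-1) <= e :> R.
  by apply: loglog_ratio_le => //; rewrite -ler_expR lnK ?posrE.
rewrite /bound -/c => h.
have -> : eps * T%:R = c * (T%:R * e) by rewrite /e; field; rewrite gt_eqF.
by rewrite ler_pM2l // -mulrA ler_pM2l.
Qed.
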